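(* Let $X=\{x_i\}_{i=1}^n$ be a point cloud in a metric space $(\mathcal X,d)$, and let $\{y_i\}_{i=1}^n$ follow the model $$y_i=f^*(x_i)+\mu^*_{z_i^*},\qquad i=1,\dots,n,$$ with $f^*\in\mathcal F_\omega(\mathcal X)$, $\boldsymbol\mu^*\in\mathbb R^M$ and $\boldsymbol z^*=(z_i^* )\in[M]^n$. Assume the connectivity $\rho_{\min}=\rho_{\min}(X)$ of $X$ satisfies $$\omega(\rho_{\min})<\frac{1}{2M}\min_{k\ne\ell}|\mu_k^*-\mu_\ell^*|.$$ Let $(\widehat f,\widehat{\boldsymbol\mu},\widehat{\boldsymbol z})$ be the solution of the zero-mean recovery problem $$\min_{f\in\mathcal F_\omega(\mathcal X),\ \boldsymbol\mu\in\mathbb R^M,\ \boldsymbol z\in[M]^n}\ \frac1n\sum_{i=1}^n\bigl(y_i-\mu_{z_i}-f(x_i)\bigr)^2\quad\text{subject to}\quad\sum_{i=1}^n f(x_i)=0 .$$ Then $$\max_{k\in[M]}|\mu_k^*-\widehat\mu_k|\le 2(M-1)\,\omega(\delta_{\rm lbl})+\Bigl|\frac1n\sum_{i=1}^n f^*(x_i)\Bigr|,$$ where $\delta_{\rm lbl}=\delta_{\rm lbl}(X,\boldsymbol z^* )$ is the label distance.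
   Context: $[M]=\{1,\dots,M\}$. For a modulus of continuity $\omega:[0,\infty)\to[0,\infty)$, $\mathcal F_\omega(\mathcal X)$ is the class of real-valued, uniformly continuous functions on $(\mathcal X,d)$ with modulus of continuity $\omega$, that is, $$\mathcal F_\omega(\mathcal X)=\{f:\mathcal X\to\mathbb R:\ |f(x)-f(x')|\le\omega(d(x,x'))\ \ \forall x,x'\in\mathcal X\}.$$ The $\rho$-neighbor graph $G_\rho(X)$ of the point cloud has vertex set $[n]$ and edge set $\{(i,j)\in[n]^2:i\ne j,\ d(x_i,x_j)\le\rho\}$; the connectivity is $\rho_{\min}(X)=\inf\{\rho>0: G_\rho(X)\text{ is connected}\}$. The clusters induced by $\boldsymbol z^*$ are $\mathcal C_k=\{i\in[n]:z_i^*=k\}$ for $k\in[M]$, with $\mathcal C=\{\mathcal C_k\}_{k\in[M]}$ and cluster distance $d(\mathcal C_k,\mathcal C_\ell)=\min_{i\in\mathcal C_k,\,j\in\mathcal C_\ell}d(x_i,x_j)$. For $\delta>0$, $G_\delta(\mathcal C)$ is the graph with vertex set $\mathcal C$ and edge set $\{(\mathcal C_k,\mathcal C_\ell):k\ne\ell,\ d(\mathcal C_k,\mathcal C_\ell)\le\delta\}$. The label distance is $\delta_{\rm lbl}(X,\boldsymbol z^* )=\inf\{\delta>0:G_\delta(\mathcal C)\text{ is connected}\}$.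
   Formalization: The bound is proved up to a permutation of the labels of the estimated centers, since relabeling a solution gives another solution and the literal bound fails; every cluster of z* is assumed nonempty, so that the label distance is finite. *)

(* Defs.v *)
From HB Require Import structures.
From mathcomp Require Export all_boot all_order all_algebra.
From mathcomp Require Export all_fingroup.
From mathcomp Require Export all_classical all_reals all_analysis.

Set Implicit Arguments.
Unset Strict Implicit.
Unset Printing Implicit Defensive.

Import Order.TTheory GRing.Theory Num.Theory.
Import numFieldNormedType.Exports.

Local Open Scope classical_set_scope.
Local Open Scope ring_scope.

(* [omega] is total on R; only its values on [0, +oo[ are constrained (and
   used). *)
Definition modulus_of_continuity (R : realType) (omega : R -> R) : Prop :=
  [/\ forall t, 0 <= t -> 0 <= omega t,
      omega 0 = 0,
      forall s t, 0 <= s -> s <= t -> omega s <= omega t &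
      omega t @[t --> 0^'+] --> (0 : R)].

Definition modulus_class (R : realType) (T : metricType R) (omega : R -> R) :
    set (T -> R) :=
  [set f | forall x x' : T, `|f x - f x'| <= omega (mdist x x')].

Definition connected_graph (V : finType) (e : rel V) : Prop :=
  forall u v, connect e u v.

Definition neighbor_graph (R : realType) (T : metricType R) (n : nat)
    (x : 'I_n -> T) (rho : R) : rel 'I_n :=
  [rel i j | (i != j) && (mdist (x i) (x j) <= rho)].

Definition connectivity (R : realType) (T : metricType R) (n : nat)
    (x : 'I_n -> T) : R :=
  inf [set rho : R | 0 < rho /\ connected_graph (neighbor_graph x rho)].

Definition cluster (n M : nat) (z : 'I_n -> 'I_M) (k : 'I_M) : {set 'I_n} :=
  [set i | z i == k]%SET.

(* A minimum over the empty set is +oo, hence the extended real values. *)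
Definition cluster_dist (R : realType) (T : metricType R) (n M : nat)
    (x : 'I_n -> T) (z : 'I_n -> 'I_M) (k l : 'I_M) : \bar R :=
  \big[Order.min/+oo%E]_(i in cluster z k)
    \big[Order.min/+oo%E]_(j in cluster z l) (mdist (x i) (x j))%:E.

(* The vertex C_k is represented by its index k. *)
Definition cluster_graph (R : realType) (T : metricType R) (n M : nat)
    (x : 'I_n -> T) (z : 'I_n -> 'I_M) (delta : R) : rel 'I_M :=
  [rel k l | (k != l) && (cluster_dist x z k l <= delta%:E)%E].

(* When some cluster is empty and 1 < M, no [cluster_graph] is connected and
   [label_dist] takes the default value 0 of [inf set0] instead of +oo: it is
   only meaningful when all the clusters are nonempty. *)
Definition label_dist (R : realType) (T : metricType R) (n M : nat)
    (x : 'I_n -> T) (z : 'I_n -> 'I_M) : R :=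
  inf [set delta : R | 0 < delta /\ connected_graph (cluster_graph x z delta)].

(* +oo when M <= 1. *)
Definition min_separation (R : realType) (M : nat) (mu : 'rV[R]_M) : \bar R :=
  \big[Order.min/+oo%E]_(p : 'I_M * 'I_M | p.1 != p.2)
    `|mu 0 p.1 - mu 0 p.2|%:E.

Definition objective (R : realType) (T : metricType R) (n M : nat)
    (x : 'I_n -> T) (y : 'I_n -> R)
    (f : T -> R) (mu : 'rV[R]_M) (z : 'I_n -> 'I_M) : R :=
  n%:R^-1 * \sum_(i < n) (y i - mu 0 (z i) - f (x i)) ^+ 2.

Definition zero_mean_feasible (R : realType) (T : metricType R) (n : nat)
    (omega : R -> R) (x : 'I_n -> T) : set (T -> R) :=
  [set f | modulus_class omega f /\ \sum_(i < n) f (x i) = 0].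

Definition zero_mean_solution (R : realType) (T : metricType R) (n M : nat)
    (omega : R -> R) (x : 'I_n -> T) (y : 'I_n -> R)
    (f : T -> R) (mu : 'rV[R]_M) (z : 'I_n -> 'I_M) : Prop :=
  zero_mean_feasible omega x f /\
  forall (f' : T -> R) (mu' : 'rV[R]_M) (z' : 'I_n -> 'I_M),
    zero_mean_feasible omega x f' ->
    objective x y f mu z <= objective x y f' mu' z'.

(* Main.v *)
Require Import Defs.
From mathcomp Require Import ring lra.
Set Implicit Arguments.
Unset Strict Implicit.
Unset Printing Implicit Defensive.

Import Order.TTheory GRing.Theory Num.Theory.
Import numFieldNormedType.Exports.
Local Open Scope classical_set_scope.
Local Open Scope ring_scope.

(* Centering [fstar] and shifting the centers fits the data exactly, so a
   minimizer fits it exactly too, and g = fstar - fhat takes at [x i] the value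
   [muhat (zhat i) - mustar (zstar i)]. Along an edge of the neighbor graph g
   varies by at most eps = 2 omega(rho_min), while M eps is less than the
   separation of the true centers; a pigeonhole argument then shows that a label
   [zhat i] determines [zstar i], hence that [zhat] is [zstar] up to a
   permutation. So g is constant on the clusters, the cluster graph bounds its
   oscillation by 2 (M - 1) omega(delta_lbl), and its mean is that of fstar. *)

(** Common form of [neighbor_graph] and [cluster_graph], so that attainment of the infimum is proved
    once for both. *)
Definition threshold_graph (R : realType) (V : finType) (D : V -> V -> \bar R)
    (t : R) : rel V :=
  [rel u v | (u != v) && (D u v <= t%:E)%E].

(* The infimum is attained: on a finite vertex set no new edge appears for
   thresholds slightly above it. *)
Lemma connected_threshold_inf (R : realType) (V : finType)
    (D : V -> V -> \bar R) (r := inf [set t : R | 0 < t /\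
      connected_graph (threshold_graph D t)]) :
  (forall u v, D u v < +oo)%E ->
  0 <= r /\ connected_graph (threshold_graph D r).
Proof.
move=> Doo; set E := [set t | _] in r *.
have E0 : E !=set0.
  (* A positive threshold above every finite value of [D], so the graph is complete. *)
  exists (1 + \sum_(p : V * V) `|fine (D p.1 p.2)|); split=> [|u v].
    by rewrite ltr_wpDr// sumr_ge0.
  have [->//|uv] := eqVneq u v; apply: connect1; rewrite /threshold_graph/= uv /=.
  have := Doo u v; case Duv: (D u v) => [a| |]//= _; last exact: leNye.
  rewrite lee_fin (bigD1 (u, v))//= Duv/=.
  have := ler_norm a; have : 0 <= \sum_(i | i != (u, v)) `|fine (D i.1 i.2)|.
    exact: sumr_ge0.
  lra.
have lb0 : lbound E 0 by move=> t [/ltW].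
split; first exact: lb_le_inf.
have Er : \forall t \near r^'+, connected_graph (threshold_graph D t).
  near=> t.
  have tr : 0 < t - r by rewrite subr_gt0; near: t; exact: nbhs_right_gt.
  have [s [_ Es]] := inf_adherent tr (conj E0 (ex_intro _ 0 lb0)).
  rewrite -/r addrC subrK => st u v.
  apply: connect_sub (Es u v) => a b /andP[ab Dab].
  apply: connect1; rewrite /threshold_graph/= ab/= (le_trans Dab)// lee_fin; exact: ltW.
have Dr : \forall t \near r^'+, forall u v,
    (D u v <= t%:E)%E -> (D u v <= r%:E)%E.
  apply: filter_forall => u; apply: filter_forall => v.
  have [Dr|] := leP (D u v) r%:E; first exact: nearW.
  have := Doo u v; case: (D u v) => [a| |]//= _; rewrite lte_fin => ra.
  near=> t; rewrite leNgt lte_fin; suff -> : t < a by [].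
  near: t; exact: nbhs_right_lt.
have [t [Et Dt]] : exists t, connected_graph (threshold_graph D t) /\
    forall u v, (D u v <= t%:E)%E -> (D u v <= r%:E)%E.
  by apply: (@filter_ex _ (nbhs r^'+)); exact: filterI.
move=> u v; apply: connect_sub (Et u v) => a b /andP[ab Dab].
by apply: connect1; rewrite /threshold_graph/= ab/= Dt.
Unshelve. all: by end_near.
Qed.

Lemma connect_exit (V : finType) (e : rel V) (P : pred V) u v :
  connect e u v -> P u -> ~~ P v -> exists a b, [/\ P a, ~~ P b & e a b].
Proof.
move=> /connectP[p pth ->].
elim: p u pth => [u _ /= ->//|w p IH u /= /andP[uw pw] Pu].
by have [Pw|nPw] := boolP (P w); [exact: IH | exists u, w].
Qed.

(* The point [p m.+1] is found where a path from [i] to [j] first leaves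
   [g <= g i + m * eps]. *)
Lemma connect_ladder (R : realType) (V : finType) (e : rel V) (g : V -> R)
    (eps : R) (m : nat) i j :
  0 <= eps -> (forall a b, e a b -> `|g a - g b| <= eps) ->
  connect e i j -> g i + m%:R * eps < g j ->
  exists p : 'I_m.+1 -> V,
    [/\ injective (g \o p) & forall k, g i <= g (p k) <= g i + m%:R * eps].
Proof.
move=> eps0 ge ij gij.
(* The [k]-th point lies above all levels of index less than [k], which will make [g \o p] strictly
   increasing. *)
have H (k : 'I_m.+1) : exists a, g i <= g a <= g i + k%:R * eps /\
    forall l : nat, (l < k)%N -> g i + l%:R * eps < g a.
  case: k => -[|k] /= km.
    by exists i; rewrite mul0r addr0 lexx.
  have [||a [b [ga gb /ge gab]]] :=
      @connect_exit _ e [pred a | g a <= g i + k%:R * eps] _ _ ij.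
  - by rewrite /= lerDl mulr_ge0.
  - rewrite /= -ltNge (le_lt_trans _ gij)// lerD2l ler_wpM2r// ler_nat.
    by rewrite -ltnS ltnW.
  rewrite /= -ltNge in gb; rewrite /= in ga; exists b; split=> [|l lk].
    rewrite -natr1 mulrDl mul1r; have : 0 <= k%:R * eps by rewrite mulr_ge0.
    by move: gab; rewrite ler_norml => /andP[]; lra.
  by rewrite (le_lt_trans _ gb)// lerD2l ler_wpM2r// ler_nat.
have [p Hp] := choice H; exists p; split; last first.
  move=> k; have [/andP[-> /=]] := Hp k; move=> /le_trans + _; apply.
  by rewrite lerD2l ler_wpM2r// ler_nat -ltnS.
have lt_p (k l : 'I_m.+1) : (k < l)%N -> g (p k) < g (p l).
  move=> kl; have [/andP[_ /le_lt_trans gk] _] := Hp k.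
  by apply: gk; have [_] := Hp l; exact.
move=> k l /= gkl; case: (ltngtP k l) => [/lt_p|/lt_p|/val_inj//].
  by rewrite gkl ltxx.
by rewrite gkl ltxx.
Qed.

(** A path without repeated vertices has at most [M - 1] edges, each costing [eps]. *)
Lemma le_norm_connect (R : realType) (M : nat) (e : rel 'I_M) (h : 'I_M -> R)
    (eps : R) k l :
  0 <= eps -> (forall a b, e a b -> `|h a - h b| <= eps) ->
  connect e k l -> `|h k - h l| <= (M%:R - 1) * eps.
Proof.
move=> eps0 he /connectP[q /shortenP[p pth up _] ->] {q}.
have : `|h k - h (last k p)| <= (size p)%:R * eps.
  elim: p k pth {up} => [k _|w p IH k /= /andP[kw pw]].
    by rewrite subrr normr0 mul0r.
  rewrite -natr1 mulrDl mul1r [leRHS]addrC (le_trans (ler_distD (h w) _ _))//.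
  by rewrite lerD// ?he// IH.
move=> /le_trans; apply; rewrite ler_wpM2r// lerBrDr natr1 ler_nat.
by have := card_uniqP up; rewrite /= => <-; rewrite -[leqRHS]card_ord max_card.
Qed.

Lemma cluster_dist_lty (R : realType) (T : metricType R) (n M : nat)
    (x : 'I_n -> T) (z : 'I_n -> 'I_M) k l :
  cluster z k != finset.set0 -> cluster z l != finset.set0 ->
  (cluster_dist x z k l < +oo)%E.
Proof.
move=> /finset.set0Pn[i ik] /finset.set0Pn[j jl].
apply: (@le_lt_trans _ _ (mdist (x i) (x j))%:E); last exact: ltry.
by apply: (bigmin_inf i) => //; apply: (bigmin_inf j).
Qed.

Lemma cluster_dist_le (R : realType) (T : metricType R) (n M : nat)
    (x : 'I_n -> T) (z : 'I_n -> 'I_M) k l (t : R) :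
  (cluster_dist x z k l <= t%:E)%E ->
  exists i j, [/\ z i = k, z j = l & mdist (x i) (x j) <= t].
Proof.
move=> /bigmin_leP[|[i]]; first by rewrite leye_eq.
rewrite inE => /eqP zi /bigmin_leP[|[j]]; first by rewrite leye_eq.
by rewrite inE => /eqP zj; rewrite lee_fin => ij; exists i, j.
Qed.

Lemma lt_min_separation (R : realType) (M : nat) (mu : 'rV[R]_M) (c : R) k l :
  ((c%:E < ((2 * M%:R)^-1)%:E * min_separation mu)%E) -> k != l ->
  M%:R * (2 * c) < `|mu 0 k - mu 0 l|.
Proof.
move=> cmu kl; have M0 : 0 < M%:R :> R by rewrite ltr0n (leq_ltn_trans _ (ltn_ord k)).
have : (c%:E < ((2 * M%:R)^-1 * `|mu 0 k - mu 0 l|)%:E)%E.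
  apply: lt_le_trans cmu _; rewrite EFinM lee_pmul2l// ?lte_fin ?invr_gt0 ?mulr_gt0//.
  exact: (bigmin_inf (k, l)).
rewrite lte_fin mulrC ltr_pdivlMr ?mulr_gt0//.
by congr (_ < _); ring.
Qed.

Lemma zero_mean_exact_fit (R : realType) (T : metricType R) (omega : R -> R)
    (n M : nat) (x : 'I_n -> T) (y : 'I_n -> R)
    (fstar : T -> R) (mustar : 'rV[R]_M) (zstar : 'I_n -> 'I_M)
    (fhat : T -> R) (muhat : 'rV[R]_M) (zhat : 'I_n -> 'I_M) :
  (0 < n)%N ->
  modulus_class omega fstar ->
  (forall i, y i = fstar (x i) + mustar 0 (zstar i)) ->
  zero_mean_solution omega x y fhat muhat zhat ->
  forall i, fstar (x i) - fhat (x i) = muhat 0 (zhat i) - mustar 0 (zstar i).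
Proof.
move=> n0 fw yE [_ opt] i.
have nR : n%:R != 0 :> R by rewrite pnatr_eq0 -lt0n.
(* Moving the mean [c] from [fstar] to the centers gives a feasible competitor with objective 0. *)
pose c := n%:R^-1 * \sum_(i < n) fstar (x i).
have := opt (fun t => fstar t - c) (mustar + const_mx c) zstar.
have -> : objective x y (fun t => fstar t - c) (mustar + const_mx c) zstar = 0.
  rewrite /objective big1 ?mulr0// => j _; rewrite yE !mxE; ring.
have feas : zero_mean_feasible omega x (fun t => fstar t - c).
  split=> [t t'|]; first by rewrite opprB addrA subrK fw.
  by rewrite sumrB sumr_const card_ord -mulr_natl /c mulVKf// subrr.
move=> /(_ feas); rewrite /objective pmulr_rle0 ?invr_gt0 ?ltr0n// => le0.
have sq0 (j : 'I_n) : xpredT j -> 0 <= (y j - muhat 0 (zhat j) - fhat (x j)) ^+ 2.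
  by rewrite sqr_ge0.
have /eqP : (y i - muhat 0 (zhat i) - fhat (x i)) ^+ 2 = 0.
  by apply: (psumr_eq0P sq0) => //; apply: le_anti; rewrite le0 sumr_ge0.
rewrite sqrf_eq0 yE => /eqP; lra.
Qed.

Lemma modulus_class_dist (R : realType) (T : metricType R) (omega : R -> R)
    (f h : T -> R) (t : R) (u v : T) :
  modulus_of_continuity omega -> modulus_class omega f ->
  modulus_class omega h -> mdist u v <= t ->
  `|(f u - h u) - (f v - h v)| <= 2 * omega t.
Proof.
move=> [_ _ w_mono _] fw hw uvt.
have wt : omega (mdist u v) <= omega t by apply: w_mono => //; exact: mdist_ge0.
have -> : f u - h u - (f v - h v) = (f u - f v) - (h u - h v) by ring.
rewrite (le_trans (ler_normB _ _))// mulrDl mul1r.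
by apply: lerD; apply: le_trans wt; [exact: fw | exact: hw].
Qed.

(* Two points with the same label [w] have values of [g] that are equal or more
   than [M * eps] apart, so the [M + 1] distinct values of a ladder within
   [M * eps] would carry [M + 1] distinct labels. *)
Lemma label_refines (R : realType) (V : finType) (M : nat) (e : rel V)
    (g : V -> R) (mu nu : 'rV[R]_M) (z w : V -> 'I_M) (eps : R) :
  0 <= eps -> connected_graph e ->
  (forall a b, e a b -> `|g a - g b| <= eps) ->
  (forall k l, k != l -> M%:R * eps < `|mu 0 k - mu 0 l|) ->
  (forall i, g i = nu 0 (w i) - mu 0 (z i)) ->
  forall i j, w i = w j -> z i = z j.
Proof.
move=> eps0 conn ge sep gE.
have far i j : w i = w j -> z i != z j -> M%:R * eps < `|g i - g j|.
  move=> wij zij; rewrite !gE wij distrC; have -> : nu 0 (w j) - mu 0 (z j) -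
    (nu 0 (w j) - mu 0 (z i)) = mu 0 (z i) - mu 0 (z j) by ring.
  exact: sep.
have low i j : w i = w j -> z i != z j -> ~ g i < g j.
  move=> wij zij gij; have := far _ _ wij zij.
  rewrite ltr0_norm ?subr_lt0// opprB ltrBrDl => gMj.
  have [p [p_inj pM]] := connect_ladder eps0 ge (conn i j) gMj.
  suff /leq_card : injective (w \o p) by rewrite !card_ord ltnn.
  move=> a b /= wab; apply: p_inj => /=; apply/eqP/negPn/negP => gab.
  have zab : z (p a) != z (p b).
    by apply: contraNneq gab => zab; rewrite !gE wab zab.
  have := far _ _ wab zab; rewrite ltNge => /negP; apply.
  by have := pM a; have := pM b; rewrite ler_norml; lra.
move=> i j wij; apply/eqP/negPn/negP => zij.
have [] := ltgtP (g i) (g j); first exact: low.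
  by apply: low => //; rewrite eq_sym.
move=> gij; have := far _ _ wij zij.
by rewrite gij subrr normr0 ltNge mulr_ge0.
Qed.

(** Choosing a representative [r k] of each class of [z] makes [w \o r] an injective self-map of a
    finite set, hence a permutation. Then [w i] is the label of some [r k], and the refinement
    forces [k = z i]. *)
Lemma labels_perm (V : finType) (M : nat) (z w : V -> 'I_M) :
  (forall k, exists i, z i = k) -> (forall i j, w i = w j -> z i = z j) ->
  exists s : 'S_M, forall i, w i = s (z i).
Proof.
move=> /choice[r zr] wz.
have inj_wr : injective (w \o r) by move=> k l /= /wz; rewrite !zr.
exists (perm inj_wr) => i; rewrite permE /=.
have [h hK Kh] := injF_bij inj_wr.
rewrite -[LHS]Kh /=; congr (w (r _)); rewrite -[LHS]zr.
by apply: wz; exact: Kh.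
Qed.

(* The objective and the constraint are invariant under relabeling
   (mu, z) |-> (mu o s^-1, s o z), so a minimizer determines its centers only
   up to a permutation s of [M]; the bound is stated modulo this permutation. *)
Theorem proposition1 (R : realType) (T : metricType R) (omega : R -> R)
    (n M : nat) (x : 'I_n -> T) (y : 'I_n -> R)
    (fstar : T -> R) (mustar : 'rV[R]_M) (zstar : 'I_n -> 'I_M)
    (fhat : T -> R) (muhat : 'rV[R]_M) (zhat : 'I_n -> 'I_M) :
  (0 < n)%N ->
  modulus_of_continuity omega ->
  modulus_class omega fstar ->
  (forall i, y i = fstar (x i) + mustar 0 (zstar i)) ->
  (forall k, cluster zstar k != finset.set0) ->
  ((omega (connectivity x))%:E
     < ((2 * M%:R)^-1)%:E * min_separation mustar)%E ->
  zero_mean_solution omega x y fhat muhat zhat ->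
  exists s : 'S_M,
    \big[Num.max/0]_(k < M) `|mustar 0 k - muhat 0 (s k)|
      <= 2 * (M%:R - 1) * omega (label_dist x zstar)
         + `|n%:R^-1 * \sum_(i < n) fstar (x i)|.
move=> n0 w_mod fw yE clus_n0 sep sol.
have gE := zero_mean_exact_fit n0 fw yE sol.
have [[fhw fh0] _] := sol.
have [w_ge0 _ _ _] := w_mod.
pose g i := fstar (x i) - fhat (x i).
have [rho0 Grho] : 0 <= connectivity x /\
    connected_graph (neighbor_graph x (connectivity x)).
  by apply: (connected_threshold_inf (D := fun i j => (mdist (x i) (x j))%:E))
    => *; exact: ltry.
have [delta0 Gdelta] : 0 <= label_dist x zstar /\
    connected_graph (cluster_graph x zstar (label_dist x zstar)).
  (* Nonempty clusters are at finite distance, so [label_dist] is a true infimum and not the default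
     0. *)
  by apply: connected_threshold_inf => *; exact: cluster_dist_lty.
set delta := label_dist x zstar in delta0 Gdelta *.
have zsurj k : exists i, zstar i = k.
  by have /finset.set0Pn[i] := clus_n0 k; rewrite inE => /eqP; exists i.
have [s zhatE] : exists s : 'S_M, forall i, zhat i = s (zstar i).
  apply: labels_perm => //.
  apply: (label_refines (g := g) (eps := 2 * omega (connectivity x)) _ Grho
    _ _ gE).
  - by rewrite mulr_ge0// w_ge0.
  - by move=> a b /andP[_ ab]; exact: modulus_class_dist.
  - by move=> k l; exact: lt_min_separation.
pose h k := muhat 0 (s k) - mustar 0 k.
have gh i : g i = h (zstar i) by rewrite /g gE zhatE.
have h_dist k l : `|h k - h l| <= (M%:R - 1) * (2 * omega delta).
  apply: le_norm_connect (Gdelta k l); first by rewrite mulr_ge0// w_ge0.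
  move=> {}k {}l /andP[_ /cluster_dist_le[i [j [<- <- ij]]]].
  by rewrite -!gh; exact: modulus_class_dist.
exists s.
have nR : n%:R != 0 :> R by rewrite pnatr_eq0 -lt0n.
have bnd k : `|mustar 0 k - muhat 0 (s k)| <=
    2 * (M%:R - 1) * omega delta + `|n%:R^-1 * \sum_(i < n) fstar (x i)|.
  set c := n%:R^-1 * _.
  (* Since [fhat] sums to zero over the sample, [c] is also the mean of [g], that is, of
     [h (zstar i)]. *)
  have cE : h k - c = n%:R^-1 * \sum_(i < n) (h k - h (zstar i)).
    rewrite sumrB sumr_const card_ord -[h k *+ n]mulr_natl mulrBr mulKf//.
    congr (_ - _ * _); rewrite -(eq_bigr _ (fun i _ => gh i)) sumrB fh0 subr0//.
  rewrite distrC -/(h k) -[h k](subrK c) (le_trans (ler_normD _ _))// lerD2r.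
  rewrite cE normrM ger0_norm ?invr_ge0// ler_pdivrMl ?ltr0n//.
  rewrite (le_trans (ler_norm_sum _ _ _))//.
  set b := 2 * _ * _; have -> : n%:R * b = \sum_(i < n) b.
    by rewrite sumr_const card_ord mulr_natl.
  apply: ler_sum => i _; rewrite (le_trans (h_dist _ _))//.
  by rewrite mulrA [_ * 2]mulrC.
(* The maximum starts from 0, so the bound must be nonnegative; [bnd] at the label of any sample
   point shows it. *)
apply: bigmax_le => // ; apply: le_trans (bnd (zstar (Ordinal n0))).
exact: normr_ge0.
Qed.
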